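(* Let $1\le k<n$ be integers. For every 1-terminal chord diagram $T$ of size $n$ with connectivity $\kappa(T)=n-k$, the connectivity $j=\kappa(\psi(T))$ satisfies $n-2k\le j<n-k$. Furthermore, for all integers $n,k,j$ with $1\le k<n$, $j\ge0$ and $n-2k\le j<n-k$, there exists a 1-terminal chord diagram $T$ of size $n$ with $\kappa(T)=n-k$ and $\kappa(\psi(T))=j$.
   Context: A chord diagram of size $n$ is a perfect matching of $\{1,\dots,2n\}$; chords are ordered pairs $(a,b)$ with $a<b$, $a$ the source and $b$ the sink. For chords $c_1=(a_1,b_1)$, $c_2=(a_2,b_2)$ with $a_1<a_2$, they cross if $a_2<b_1<b_2$, and then $c_2$ is a right neighbor of $c_1$. The intersection graph has chords as vertices and crossings as edges. The connectivity $\kappa(C)$ of a diagram is the vertex connectivity of its (undirected) intersection graph: the minimum number of vertices whose removal disconnects it, with the usual convention that a complete graph on $m$ vertices has connectivity $m-1$. A chord is terminal if it has no right neighbors. A diagram is 1-terminal if no chord other than the last one, in the order of sources, is terminal. The map $\psi$ from 1-terminal diagrams of size $n$ to diagrams of size $n-1$ ($n\ge 2$): let $T$ be 1-terminal with chords $c_1<\dots<c_n$ ordered by source. The source-sink group of a chord $c$ consists of the source of $c$ together with the maximal run of consecutive sinks immediately following it (excluding the sink of $c$ itself). Then $\psi(T)$ is obtained from $T$ by (1) moving each source to the end of its source-sink group (all other endpoints keeping their relative order and every source staying paired with its sink), and (2) deleting the terminal chord $c_n$; endpoints are then relabelled order-preservingly. *)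

(* Defs.v *)
From mathcomp Require Import all_boot.
From mathcomp Require Import zify.

Set Implicit Arguments.
Unset Strict Implicit.
Unset Printing Implicit Defensive.

Section Connectivity.
Variables (V : finType) (e : rel V).

Definition complete_graph : bool := [forall x, forall y, (x != y) ==> e x y].

Definition remove_vertices (S : {set V}) : rel V :=
  [rel x y | [&& x \notin S, y \notin S & e x y]].

Definition disconnects (S : {set V}) : bool :=
  [exists x, exists y,
     [&& x \notin S, y \notin S & ~~ connect (remove_vertices S) x y]].

(* A graph that is not complete is disconnected by some set of vertices, so the
   default value #|V| of the minimum is never reached. *)
Definition vertex_connectivity : nat :=
  if complete_graph then #|V|.-1
  else \big[minn/#|V|]_(S : {set V} | disconnects S) #|S|.

End Connectivity.

Definition chord : Type := (nat * nat)%type.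
Definition source (c : chord) : nat := c.1.
Definition sink (c : chord) : nat := c.2.

Definition sources (C : seq chord) : seq nat := [seq source c | c <- C].
Definition sinks (C : seq chord) : seq nat := [seq sink c | c <- C].
Definition endpoints (C : seq chord) : seq nat := sources C ++ sinks C.

(* A perfect matching of {1, ..., 2n}, given as the list c_1 < ... < c_n of its
   chords in the order of their sources. *)
Definition is_diagram (n : nat) (C : seq chord) : bool :=
  [&& sorted ltn (sources C), all (fun c => source c < sink c) C
    & perm_eq (endpoints C) (iota 1 (2 * n))].

Record diagram (n : nat) := Diagram {
  chords :> seq chord;
  chordsP : is_diagram n chords }.

Definition right_neighbor (c1 c2 : chord) : bool :=
  [&& source c1 < source c2, source c2 < sink c1 & sink c1 < sink c2].

Definition crossing (c1 c2 : chord) : bool :=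
  right_neighbor c1 c2 || right_neighbor c2 c1.

Definition nth_chord (C : seq chord) (i : nat) : chord := nth (0, 0) C i.

(* The vertex i : 'I_n stands for the chord c_(i+1). *)
Definition intersection_graph (n : nat) (T : diagram n) : rel 'I_n :=
  [rel i j : 'I_n | crossing (nth_chord T i) (nth_chord T j)].

Definition connectivity (n : nat) (T : diagram n) : nat :=
  vertex_connectivity (intersection_graph T).

Definition terminal (C : seq chord) (c : chord) : bool :=
  ~~ has (right_neighbor c) C.

Definition one_terminal (n : nat) (T : diagram n) : bool :=
  [forall i : 'I_n, (i.+1 < n) ==> ~~ terminal T (nth_chord T i)].

(* Number of sinks in the source-sink group of c: the points following the
   source of c are read up to the first one that is not a sink, or is the sink
   of c itself.  The group occupies the points from source c to
   source c + group_sinks C c.  (The sink of c can only interrupt the run when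
   c is terminal.) *)
Definition group_sinks (C : seq chord) (c : chord) : nat :=
  find (fun x => (x \notin sinks C) || (x == sink c))
       (iota (source c).+1 (2 * size C)).

Definition in_group (C : seq chord) (c : chord) (x : nat) : bool :=
  source c <= x <= source c + group_sinks C c.

(* Moving each source to the end of its group shifts the sinks of the group one
   place to the left. *)
Definition moved_chord (C : seq chord) (c : chord) : chord :=
  (source c + group_sinks C c,
   sink c - has (fun d => in_group C d (sink c)) C).

Definition move_sources (C : seq chord) : seq chord :=
  [seq moved_chord C c | c <- C].

Definition delete_last (C : seq chord) : seq chord := take (size C).-1 C.

Definition rank_in (s : seq nat) (x : nat) : nat := count (fun y => y <= x) s.

Definition relabel (C : seq chord) : seq chord :=
  [seq (rank_in (endpoints C) (source c), rank_in (endpoints C) (sink c))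
     | c <- C].

Definition psi_chords (C : seq chord) : seq chord :=
  relabel (delete_last (move_sources C)).

Lemma size_endpoints C : size (endpoints C) = 2 * size C.
Proof. by rewrite size_cat !size_map addnn mul2n. Qed.

Lemma size_diagram n C : is_diagram n C -> size C = n.
Proof.
case/and3P=> _ _ /perm_size; rewrite size_endpoints size_iota.
by move=> h; lia.
Qed.

Lemma rank_in_lt s x y : y \in s -> x < y -> rank_in s x < rank_in s y.
Proof.
move=> ys xy; rewrite /rank_in.
have sub : subpred (fun z => z <= x) (fun z => z <= y) by move=> z /=; lia.
elim: s ys => //= z s IH; rewrite inE => /orP[/eqP <-|/IH]; last by lia.
have := sub_count sub s; rewrite leqnn; lia.
Qed.

Lemma relabel_diagram n C :
    size C = n -> sorted ltn (sources C) -> all (fun c => source c < sink c) C ->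
  uniq (endpoints C) -> is_diagram n (relabel C).
Proof.
move=> sC srt lt un; set r := rank_in (endpoints C).
have mono x y : x \in endpoints C -> y \in endpoints C -> x < y -> r x < r y.
  by move=> _; exact: rank_in_lt.
have srcE c : c \in C -> source c \in endpoints C.
  by move=> cC; rewrite mem_cat map_f.
have snkE c : c \in C -> sink c \in endpoints C.
  by move=> cC; rewrite mem_cat (map_f sink) ?orbT.
have srcR : sources (relabel C) = map r (sources C) by rewrite /sources -!map_comp.
have snkR : sinks (relabel C) = map r (sinks C) by rewrite /sinks -!map_comp.
apply/and3P; split.
- rewrite srcR sorted_map.
  apply: (@sub_in_sorted _ (mem (endpoints C)) ltn) srt => [x y xE yE|].
    exact: mono.
  by apply/allP => _ /mapP[c cC ->]; exact: srcE.
- rewrite all_map; apply/allP => c cC /=.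
  by apply: mono; rewrite ?srcE ?snkE //; apply: (allP lt).
- have -> : endpoints (relabel C) = map r (endpoints C).
    by rewrite /endpoints srcR snkR map_cat.
  have unr : uniq (map r (endpoints C)).
    rewrite map_inj_in_uniq // => x y xE yE exy.
    by case: (ltngtP x y) => // h; [have := mono _ _ xE yE h|have := mono _ _ yE xE h];
      rewrite exy ltnn.
  apply: uniq_perm; rewrite ?iota_uniq //.
  have [] // := uniq_min_size unr (s2 := iota 1 (2 * n)).
    move=> _ /mapP[x xE ->]; rewrite mem_iota; apply/andP; split.
      by rewrite /r /rank_in -has_count; apply/hasP; exists x.
    by rewrite add1n ltnS -sC -size_endpoints count_size.
  by rewrite size_iota size_map size_endpoints sC.
Qed.

Lemma group_sinksP C c x :
    source c < x <= source c + group_sinks C c ->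
  (x \in sinks C) && (x != sink c).
Proof.
case/andP=> cx xr; have lt : x - (source c).+1 < group_sinks C c by lia.
have := before_find 0 lt; rewrite nth_iota; last first.
  by apply: leq_trans lt _; rewrite -[leqRHS](size_iota (source c).+1) find_size.
by rewrite subnKC //= => /negbT; rewrite negb_or negbK.
Qed.

Lemma uniq_map_inj (A B : eqType) (f : A -> B) (s : seq A) :
  uniq (map f s) -> {in s &, injective f}.
Proof.
elim: s => //= a s IH /andP[fa us] x y.
rewrite !inE => /orP[/eqP->|xs] /orP[/eqP->|ys] e //.
- by rewrite e map_f in fa.
- by rewrite -e map_f in fa.
- exact: IH.
Qed.

Lemma move_sources_wf n C : is_diagram n C ->
  [/\ sorted ltn (sources (move_sources C)),
      all (fun c => source c < sink c) (move_sources C)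
    & uniq (endpoints (move_sources C))].
Proof.
case/and3P=> srt /allP lt /perm_uniq; rewrite iota_uniq cat_uniq.
case/and3P=> unS /hasP disj unT.
have srcN c d : c \in C -> d \in C -> source c <> sink d.
  move=> cC dC e; apply: disj; exists (sink d); first exact: (map_f sink).
  by rewrite /= -e map_f.
have srcG c d : c \in C -> d \in C ->
    ~~ (source c < source d <= source c + group_sinks C c).
  move=> cC dC; apply/negP => /group_sinksP/andP[/mapP[e eC]].
  by move/(srcN _ _ dC eC).
have ownG c : c \in C -> source c + group_sinks C c < sink c.
  move=> cC; rewrite ltnNge; apply/negP => h.
  by have := @group_sinksP C c (sink c); rewrite lt // h eqxx andbF => /(_ isT).
have injS := uniq_map_inj unS; have injT := uniq_map_inj unT.
have srcM c : source (moved_chord C c) = source c + group_sinks C c by [].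
have snkM c : sink (moved_chord C c)
    = sink c - has (fun d => in_group C d (sink c)) C by [].
have sinkP c : c \in C ->
    (exists d, [/\ d \in C, source d < sink c <= source d + group_sinks C d
       & sink (moved_chord C c) = (sink c).-1]) \/
    ((forall d, d \in C -> ~~ (source d <= sink c <= source d + group_sinks C d))
       /\ sink (moved_chord C c) = sink c).
  move=> cC; rewrite !snkM.
  have [/hasP[d dC]|/hasPn h] := boolP (has _ _); last first.
    by right; split=> [d /h|]; rewrite ?subn0.
  rewrite /in_group => h; left; exists d; split=> //; last by rewrite subn1.
  by have := srcN _ _ dC cC; lia.
have srt' : sorted ltn (sources (move_sources C)).
  rewrite /sources /move_sources -map_comp sorted_map.
  rewrite /sources sorted_map in srt.
  apply: (@sub_in_sorted _ (mem C)) srt => [c d cC dC h|]; last exact/allP.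
  have {}h : source c < source d by [].
  change (source c + group_sinks C c < source d + group_sinks C d).
  by have := srcG c d cC dC; lia.
split=> //.
- rewrite all_map; apply/allP => c cC.
  change (source c + group_sinks C c < sink (moved_chord C c)).
  have := ownG _ cC.
  case: (sinkP _ cC) => [[d [dC h ->]]|[_ ->]] //.
  have := srcG c d cC dC; have := srcG d c dC cC; have := srcN d c dC cC.
  have [e|] := eqVneq (source c) (source d); last by lia.
  by rewrite -(injS _ _ cC dC e) in h *; lia.
- rewrite cat_uniq (sorted_uniq ltn_trans ltnn srt') /=; apply/andP; split.
    apply/hasPn => _ /mapP[_ /mapP[c cC ->] ->]; apply/negP.
    case/mapP=> _ /mapP[d dC ->]; rewrite srcM.
    case: (sinkP _ cC) => [[e [eC h ->]]|[h ->]] E; last first.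
      by have := h d dC; lia.
    have := srcG d e dC eC; have := srcG e d eC dC.
    have [ed|] := eqVneq (source d) (source e); last by lia.
    by rewrite (injS _ _ dC eC ed) in E; lia.
  rewrite /sinks /move_sources -map_comp map_inj_in_uniq; last first.
    move=> c d cC dC.
    change (sink (moved_chord C c) = sink (moved_chord C d) -> c = d).
    case: (sinkP _ cC) => [[e [eC h ->]]|[h ->]];
    case: (sinkP _ dC) => [[f [fC k ->]]|[k ->]] E; apply: injT => //.
    - by lia.
    - by have := k e eC; lia.
    - by have := h f fC; lia.
  exact: map_uniq unT.
Qed.

Lemma psi_chordsP n (T : diagram n) : is_diagram n.-1 (psi_chords T).
Proof.
have sT := size_diagram (chordsP T).
have [srt lt un] := move_sources_wf (chordsP T).
have sM : size (move_sources T) = n by rewrite size_map.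
rewrite /psi_chords /delete_last sM; apply: relabel_diagram.
- by rewrite size_takel // sM leq_pred.
- by rewrite /sources map_take take_sorted.
- by apply/allP => c /mem_take; exact: (allP lt).
- apply: subseq_uniq un; rewrite /endpoints /sources /sinks !map_take.
  by apply: cat_subseq; exact: take_subseq.
Qed.

(* The construction makes sense for every diagram, which lets psi be a total
   function extending the map defined on 1-terminal diagrams. *)
Definition psi (n : nat) (T : diagram n) : diagram n.-1 :=
  Diagram (psi_chordsP T).

(* Main.v *)
(* Number the chords of a 1-terminal T as 0, ..., m by their sources, with
   endpoints s i < t i.  Then psi T has, up to the order of the endpoints, the
   chords (s (i + 1), t i) for i < m: its intersection graph is that of T without
   the vertex m and without the edges from each i to its last right neighbor.

   A set separating a circle graph contains all chords crossing the boundary of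
   some interval that has a chord inside it and a chord outside it; conversely
   these chords form a separator.  Applying this to T, shifting the sources frees
   one chord of the separator, whence kappa (psi T) < kappa T.  Applying it to
   psi T, the corresponding interval separates T at the cost of two more chords,
   unless it contains only one chord x of psi T; then the separator contains the
   neighbors of x, and the number of edges lost at x is at most k. *)

Require Import Defs.
From mathcomp Require Import all_boot.
From mathcomp Require Import zify.

Set Implicit Arguments.
Unset Strict Implicit.
Unset Printing Implicit Defensive.

(** * Vertex connectivity *)

Section Connectivity.
Variables (V : finType) (e : rel V).

(** [P] is closed under the edges avoiding [S], so it contains the component of [x]. The separators
    below are certified in this way. *)
Lemma disconnects_pred (S : {set V}) (P : pred V) x y :
    x \notin S -> y \notin S -> P x -> ~~ P y ->
    (forall u v, u \notin S -> v \notin S -> e u v -> P u -> P v) ->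
  disconnects e S.
Proof.
move=> xS yS Px Py cl; apply/existsP; exists x; apply/existsP; exists y.
rewrite xS yS /=; apply: contra Py => /connectP[p].
elim: p x Px {xS} => [|z p IH] u Pu /=; first by move=> _ ->.
case/andP=> /and3P[uS zS uz] pth; apply: IH pth; exact: cl uz Pu.
Qed.

Lemma disconnects_nonadjacent x y :
  x != y -> ~~ e x y -> disconnects e (~: [set x; y]).
Proof.
move=> xy nxy; apply: (@disconnects_pred _ (pred1 x) x y); rewrite ?inE ?eqxx ?orbT //=.
  by rewrite eq_sym.
move=> u v; rewrite !inE !negbK => _ /orP[/eqP-> //|/eqP->] uy /eqP ux.
by rewrite -ux uy in nxy.
Qed.

Lemma complete_disconnects S : complete_graph e -> ~~ disconnects e S.
Proof.
move=> /forallP cpl; apply/negP => /existsP[x /existsP[y /and3P[xS yS]]].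
have [->|xy] := eqVneq x y; first by rewrite connect0.
have := forallP (cpl x) y; rewrite xy /= => exy.
by move/negP; apply; apply: connect1; exact/and3P.
Qed.

Lemma leq_vertex_connectivity m :
    m <= #|V|.-1 -> (forall S, disconnects e S -> m <= #|S|) ->
  m <= vertex_connectivity e.
Proof.
move=> mV mS; rewrite /vertex_connectivity; case: ifP => // _.
apply: (big_ind (leq m)) => //; first by lia.
by move=> a b; rewrite leq_min => -> ->.
Qed.

Lemma vertex_connectivity_leq S : disconnects e S -> vertex_connectivity e <= #|S|.
Proof.
move=> dS; rewrite /vertex_connectivity ifN; last first.
  by apply: contraL dS; exact: complete_disconnects.
have := mem_index_enum S; elim: (index_enum _) => //= X r IH.
rewrite inE big_cons => /orP[/eqP<-|/IH]; first by rewrite dS geq_minl.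
by case: ifP => // _; rewrite geq_min orbC => ->.
Qed.

Lemma min_separator :
  complete_graph e \/ exists2 S, disconnects e S & vertex_connectivity e = #|S|.
Proof.
have [|nc] := boolP (complete_graph e); [by left | right].
have [S0 dS0] : exists S, disconnects e S.
  move: nc; rewrite negb_forall => /existsP[x]; rewrite negb_forall.
  case/existsP=> y; rewrite negb_imply => /andP[xy nxy].
  by exists (~: [set x; y]); exact: disconnects_nonadjacent.
case: (arg_minnP (fun S : {set V} => #|S|) dS0) => S dS minS; exists S => //.
apply/eqP; rewrite eqn_leq vertex_connectivity_leq //.
rewrite /vertex_connectivity (negbTE nc).
apply: (big_ind (leq #|S|)) => //; first exact: max_card.
by move=> a b; rewrite leq_min => -> ->.
Qed.

Lemma vertex_connectivity_leq_card : vertex_connectivity e <= #|V|.-1.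
Proof.
have [cpl|] := boolP (complete_graph e); first by rewrite /vertex_connectivity cpl.
rewrite negb_forall => /existsP[x]; rewrite negb_forall.
case/existsP=> y; rewrite negb_imply => /andP[xy nxy].
apply: leq_trans (vertex_connectivity_leq (disconnects_nonadjacent xy nxy)) _.
by have := cardsC [set x; y]; rewrite cards2 xy; lia.
Qed.

(** Either [x] is adjacent to all other vertices, or its neighbors separate it from a
    non-neighbor. *)
Lemma vertex_connectivity_leq_degree x :
  ~~ e x x -> vertex_connectivity e <= #|[set y | e x y]|.
Proof.
move=> nxx; have [/forallP nb|] := boolP [forall y, (y != x) ==> e x y].
  apply: leq_trans vertex_connectivity_leq_card _.
  have <- : #|[set~ x]| = #|V|.-1 by rewrite cardsC1.
  by apply/subset_leq_card/subsetP => y; rewrite !inE; exact/implyP.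
rewrite negb_forall => /existsP[y]; rewrite negb_imply => /andP[yx nxy].
apply: vertex_connectivity_leq.
apply: (@disconnects_pred _ (pred1 x) x y); rewrite ?inE ?eqxx //.
by move=> u v _; rewrite inE => nxv uv /eqP ux; rewrite -ux uv in nxv.
Qed.

Lemma eq_vertex_connectivity (e' : rel V) :
  e =2 e' -> vertex_connectivity e = vertex_connectivity e'.
Proof.
move=> ee; rewrite /vertex_connectivity.
have -> : complete_graph e = complete_graph e'.
  by apply: eq_forallb => x; apply: eq_forallb => y; rewrite ee.
case: ifP => // _; apply: eq_bigl => S.
apply: eq_existsb => x; apply: eq_existsb => y; do 2!congr (_ && _).
by congr (~~ _); apply: eq_connect => u v; rewrite /remove_vertices /= -ee.
Qed.

End Connectivity.

(** * Circle graphs and intervals *)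

(** Crossings depend only on the order of the endpoints, so these need not fill [1, ..., 2m]. This
    admits the pairs [(s i.+1, t i)] without relabelling. *)
Record chord_model (m : nat) (s t : nat -> nat) : Prop := ChordModel {
  source_lt_sink : forall i, i < m -> s i < t i;
  source_mono : forall i j, i < j -> j < m -> s i < s j;
  sink_inj : forall i j, i < m -> j < m -> t i = t j -> i = j;
  source_neq_sink : forall i j, i < m -> j < m -> s i <> t j }.

Definition chord_graph (m : nat) (s t : nat -> nat) : rel 'I_m :=
  [rel i j : 'I_m | crossing (s i, t i) (s j, t j)].
Arguments chord_graph : clear implicits.

Lemma chord_graph_sym m s t : symmetric (chord_graph m s t).
Proof. by move=> i j; rewrite /chord_graph /= /crossing orbC. Qed.

Lemma chord_graph_irrefl m s t i : ~~ chord_graph m s t i i.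
Proof. by rewrite /chord_graph /= /crossing /right_neighbor /= !ltnn. Qed.

Definition inside (a b x : nat) : bool := a <= x < b.

Definition crosses_interval (m : nat) (s t : nat -> nat) (a b : nat) : {set 'I_m} :=
  [set i : 'I_m | inside a b (s i) != inside a b (t i)].
Arguments crosses_interval : clear implicits.

Section Intervals.
Variables (m : nat) (s t : nat -> nat).
Hypothesis wf : chord_model m s t.

(** Endpoints of crossing chords alternate, which is impossible when one pair lies in [[a, b)] and
    the other avoids it. *)
Lemma chord_graph_inside a b (u v : 'I_m) :
    inside a b (s u) = inside a b (t u) -> inside a b (s v) = inside a b (t v) ->
  chord_graph m s t u v -> inside a b (s u) = inside a b (s v).
Proof.
rewrite /chord_graph /= /crossing /right_neighbor /source /sink /= /inside.
move=> su sv /orP[] /and3P[]; move: su sv; clear; do 4!case: leqP; lia.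
Qed.

Lemma interval_disconnects a b (x y : 'I_m) :
    inside a b (s x) -> inside a b (t x) -> ~~ inside a b (s y) ->
    ~~ inside a b (t y) -> disconnects (chord_graph m s t) (crosses_interval m s t a b).
Proof.
move=> sx tx sy ty; apply: (@disconnects_pred _ _ _ (fun i : 'I_m => inside a b (s i)) x y) => //.
- by rewrite inE sx tx.
- by rewrite inE (negbTE sy) (negbTE ty).
by move=> u v; rewrite !inE !negbK => /eqP su /eqP sv /(chord_graph_inside su sv) <-.
Qed.

(* If R is the complement of S and X is the component of x in R, no chord of
   R \ X separates two endpoints of X.  Hence no chord of R crosses a gap of X,
   nor the span of X; one of these two separates x from y. *)
Lemma separator_interval (S : {set 'I_m}) :
  disconnects (chord_graph m s t) S ->
  exists a b (x y : 'I_m),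
    [/\ inside a b (s x), inside a b (t x), ~~ inside a b (s y),
        ~~ inside a b (t y) & crosses_interval m s t a b \subset S].
Proof.
case/existsP=> x /existsP[y /and3P[xS yS nxy]].
pose X (z : 'I_m) := connect (remove_vertices (chord_graph m s t) S) x z.
pose E (p : nat) := [exists z, X z && ((p == s z) || (p == t z))].
have XS z : X z -> z \notin S.
  move=> /connectP[p pth ->]; elim/last_ind: p pth => //= p u _.
  by rewrite rcons_path last_rcons => /andP[_ /and3P[]].
have adj z w : X z -> w \notin S -> ~~ X w -> ~~ chord_graph m s t z w.
  move=> Xz wS; apply: contra => zw.
  by apply: (connect_trans Xz); apply: connect1; rewrite /remove_vertices /= wS XS.
(* Consecutive chords on a path in X cross each other but not [w], so lying between the endpoints of
   [w] propagates from [s x] to every endpoint of X. *)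
have side w p q : w \notin S -> ~~ X w -> E p -> E q ->
    (s w < p < t w) = (s w < q < t w).
  move=> wS Xw.
  suff H r : E r -> (s w < r < t w) = (s w < s x < t w).
    by move=> /H-> /H->.
  case/existsP=> z /andP[Xz rz].
  have zw : z != w by apply: contra Xw => /eqP<-.
  have neq : nat_of_ord z <> nat_of_ord w by move=> /val_inj e; rewrite e eqxx in zw.
  have one u : u < m -> nat_of_ord w <> u -> ~~ crossing (s u, t u) (s w, t w) ->
     (s w < t u < t w) = (s w < s u < t w).
    move=> um wu.
    have := source_lt_sink wf um; have := source_lt_sink wf (ltn_ord w).
    have : s u <> s w.
      case: (ltngtP u w) => h; last by lia.
      by have := source_mono wf h (ltn_ord w); lia.
    by have := source_mono wf h um; lia.
    have : t u <> t w by move/(sink_inj wf um (ltn_ord w)); lia.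
    have := source_neq_sink wf um (ltn_ord w).
    have := source_neq_sink wf (ltn_ord w) um.
    rewrite /crossing /right_neighbor /source /sink /=; lia.
  have -> : (s w < r < t w) = (s w < s z < t w).
    case/orP: rz => /eqP-> //; apply: one => //; first by lia.
    exact: adj.
  case/connectP: Xz => l; elim/last_ind: l z {rz zw neq} => [|l u IH] z /=.
    by move=> _ ->.
  rewrite rcons_path last_rcons => /andP[pth lu] ->.
  rewrite -(IH _ pth erefl).
  set v := last x l in lu *.
  have Xv : X v by apply/connectP; exists l.
  have Xu : X u by apply: (connect_trans Xv (connect1 lu)).
  case/and3P: lu => _ _ vu.
  have neq a : X a -> nat_of_ord w <> nat_of_ord a.
    by move=> Xa /val_inj e; rewrite e Xa in Xw.
  have := one _ (ltn_ord v) (neq _ Xv) (adj _ _ Xv wS Xw).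
  have := one _ (ltn_ord u) (neq _ Xu) (adj _ _ Xu wS Xw).
  move: vu; rewrite /chord_graph /= /crossing /right_neighbor /source /sink /=; lia.
have Es z : X z -> E (s z) by move=> Xz; apply/existsP; exists z; rewrite Xz eqxx.
have Et z : X z -> E (t z) by move=> Xz; apply/existsP; exists z; rewrite Xz eqxx orbT.
have Xx : X x by exact: connect0.
have noE w p : w \notin S -> ~~ X w -> E p -> p <> s w /\ p <> t w.
  move=> wS Xw /existsP[z /andP[Xz pz]].
  have neq : nat_of_ord z <> nat_of_ord w.
    by move=> /val_inj e; rewrite e in Xz; rewrite Xz in Xw.
  have : s z <> s w.
    case: (ltngtP z w) => h; last by [].
      by have := source_mono wf h (ltn_ord w); lia.
    by have := source_mono wf h (ltn_ord z); lia.
  have : t z <> t w by move/(sink_inj wf (ltn_ord z) (ltn_ord w)).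
  have := source_neq_sink wf (ltn_ord z) (ltn_ord w).
  have := source_neq_sink wf (ltn_ord w) (ltn_ord z).
  by case/orP: pz => /eqP->; lia.
have bnd p : E p -> p <= \max_(z : 'I_m) t z.
  case/existsP=> z /andP[_ pz].
  have tz : t z <= \max_(w : 'I_m) t w by exact: (@leq_bigmax _ (fun w : 'I_m => t w)).
  move: tz; set mx := \max_(_ < _) _ => tz.
  by have := source_lt_sink wf (ltn_ord z); case/orP: pz => /eqP->; lia.
have exE : exists p, E p by exists (s x); exact: Es.
have sty := source_lt_sink wf (ltn_ord y).
case: (ex_minnP exE) => lo Elo minlo; case: (ex_maxnP exE bnd) => hi Ehi maxhi.
(* If [y] is not nested in the span of X, both its endpoints avoid that span, which is then the
   interval; [hi.+1] makes it contain [hi]. *)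
have [nested|not_nested] := boolP ((lo < s y) && (t y < hi)); last first.
  have [lohi [los lot]] := (maxhi lo Elo, noE _ _ yS nxy Elo).
  have [his hit] := noE _ _ yS nxy Ehi.
  have sep := side _ _ _ yS nxy Elo Ehi.
  exists lo, hi.+1, x, y; split; rewrite /inside.
  - by rewrite minlo ?ltnS ?maxhi //; exact: Es.
  - by rewrite minlo ?ltnS ?maxhi //; exact: Et.
  - by move: not_nested sep sty; lia.
  - by move: not_nested sep sty; lia.
  apply/subsetP => z; rewrite inE; apply: contraR => zS; rewrite /inside.
  have [Xz|Xz] := boolP (X z).
    by rewrite !minlo ?ltnS ?maxhi //; (exact: Es || exact: Et).
  have [? ?] := noE _ _ zS Xz Elo; have [? ?] := noE _ _ zS Xz Ehi.
  by have := side _ _ _ zS Xz Elo Ehi; have := source_lt_sink wf (ltn_ord z); lia.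
(* Otherwise [y] lies in a gap of X. The interval is the open gap between the endpoints [u] and [v]
   of X, with [y] inside and [x] outside. *)
case/andP: nested => lo_y y_hi.
have exl : exists p, E p && (p < s y) by exists lo; rewrite Elo.
have exr : exists p, E p && (t y < p) by exists hi; rewrite Ehi.
have bndl p : E p && (p < s y) -> p <= s y by case/andP=> _ /ltnW.
case: (ex_maxnP exl bndl) => u /andP[Eu uy] maxu.
case: (ex_minnP exr) => v /andP[Ev yv] minv.
have gap p : E p -> ~~ (u < p < v).
  move=> Ep; have [? ?] := noE _ _ yS nxy Ep; have := side _ _ _ yS nxy Ep Eu.
  have := maxu p; have := minv p; rewrite Ep /=; lia.
exists u.+1, v, y, x; split; rewrite /inside.
- by lia.
- by lia.
- by apply: gap; exact: Es.
- by apply: gap; exact: Et.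
apply/subsetP => z; rewrite inE; apply: contraR => zS; rewrite /inside.
have [Xz|Xz] := boolP (X z).
  by rewrite (negbTE (gap _ (Es _ Xz))) (negbTE (gap _ (Et _ Xz))).
have [? ?] := noE _ _ zS Xz Eu; have [? ?] := noE _ _ zS Xz Ev.
by have := side _ _ _ zS Xz Eu Ev; have := source_lt_sink wf (ltn_ord z); lia.
Qed.

End Intervals.

(** * Deleting the last right neighbors *)

Section Shift.
Variables (m : nat) (s t : nat -> nat).
Hypothesis wf : chord_model m.+1 s t.
Hypothesis m_gt0 : 0 < m.
(** The next two conditions come from 1-terminality: a right neighbor of [i] starts no earlier than
    chord [i.+1], and passing to right neighbors raises the sink until [m] is reached. *)
Hypothesis next_source_lt : forall i, i < m -> s i.+1 < t i.
Hypothesis last_sink : forall i, i < m -> t i < t m.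

Let s' i := s i.+1.
Let G := chord_graph m.+1 s t.
Let G' := chord_graph m s' t.
Let up : 'I_m -> 'I_m.+1 := widen_ord (leqnSn m).

Lemma inside_between a b x y z :
  inside a b x -> inside a b z -> x <= y -> y <= z -> inside a b y.
Proof. by rewrite /inside => /andP[ax _] /andP[_ zb] xy yz; lia. Qed.

Lemma source_leq i j : i <= j -> j <= m -> s i <= s j.
Proof.
rewrite leq_eqVlt => /orP[/eqP->//|ij] jm; apply: ltnW.
exact: (source_mono wf ij jm).
Qed.

Lemma chord_model_shift : chord_model m s' t.
Proof.
split=> [i im|i j ij jm|i j im jm|i j im jm].
- exact: next_source_lt.
- exact: (source_mono wf).
- by apply: (sink_inj wf); apply: ltnW.
- by apply: (source_neq_sink wf) => //; apply: ltnW.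
Qed.

(** Shifting keeps the order of the sources and moves each to the right, so it may destroy crossings
    but creates none. *)
Lemma shift_edge i j : G' i j -> G (up i) (up j).
Proof.
rewrite /G /G' /chord_graph /= /crossing /right_neighbor /source /sink /= /s'.
move: (ltn_ord i) (ltn_ord j) => im jm.
have hi : s i < s i.+1 by exact: (source_mono wf).
have hj : s j < s j.+1 by exact: (source_mono wf).
have hij : s i.+1 < s j.+1 -> s i < s j.
  case: (ltngtP i j) => [h _|h|->]; last by lia.
    by apply: (source_mono wf h); lia.
  by have := source_leq h; lia.
have hji : s j.+1 < s i.+1 -> s j < s i.
  case: (ltngtP i j) => [h|h _|->]; last by lia.
    by have := source_leq h; lia.
  by apply: (source_mono wf h); lia.
lia.
Qed.

Lemma card_lt_up (S : {set 'I_m.+1}) (S' : {set 'I_m}) z :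
  z \in S -> (forall i, i \in S' -> up i \in S /\ up i != z) -> #|S'| < #|S|.
Proof.
move=> zS sub; rewrite (cardsD1 z S) zS add1n ltnS.
rewrite -(card_imset S' (f := up)); last by move=> i j [] /val_inj.
apply/subset_leq_card/subsetP => _ /imsetP[i iS' ->].
by have [? ?] := sub i iS'; rewrite !inE; apply/andP.
Qed.

(* The last source in [a, b) belongs to a chord p whose sink is not in [a, b),
   by 1-terminality; psi moves the source of p out of [a, b), so p is no longer
   needed in the separator. *)
Lemma shift_connectivity_lt_interval a b (x : 'I_m.+1) :
    inside a b (s x) -> inside a b (t x) ->
    ~~ inside a b (s m) -> ~~ inside a b (t m) ->
  vertex_connectivity G' < #|crosses_interval m.+1 s t a b|.
Proof.
move=> sx tx sm tm.
have bnd i : (i <= m) && inside a b (s i) -> i <= m by case/andP.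
have exi : exists i, (i <= m) && inside a b (s i) by exists x; rewrite -ltnS ltn_ord.
case: (ex_maxnP exi bnd) => p /andP[pm sp] maxp.
have {}pm : p < m by rewrite ltn_neqAle pm andbT; apply: contraNneq sm => <-.
have spp : ~~ inside a b (s p.+1) by apply/negP => h; have := maxp p.+1; rewrite pm h; lia.
have tp : ~~ inside a b (t p).
  have := next_source_lt pm; have : s p < s p.+1 by exact: (source_mono wf).
  by move: sp spp; rewrite /inside; lia.
have xm : x < m.
  have := ltn_ord x; rewrite ltnS leq_eqVlt => /orP[/eqP e|//].
  by rewrite -e sx in sm.
pose CR := crosses_interval m.+1 s t a b.
pose p' := Ordinal pm; pose x' := Ordinal xm.
pose S' : {set 'I_m} := [set i | (up i \in CR) && (i != p')].
have pCR : up p' \in CR by rewrite inE /= sp (negbTE tp).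
apply: (@leq_ltn_trans #|S'|); last first.
  apply: (card_lt_up pCR) => i; rewrite in_set => /andP[iC ip]; split; first exact: iC.
  by apply: contra ip => /eqP[] e; apply/eqP; exact: val_inj.
apply: vertex_connectivity_leq.
apply: (@disconnects_pred _ _ _ (fun i : 'I_m => inside a b (s i) && inside a b (t i)) x' p').
- by rewrite !inE /= sx tx.
- by rewrite inE eqxx andbF.
- by rewrite /= sx.
- by rewrite /= (negbTE tp) andbF.
move=> u v; rewrite !inE /= => uS vS uv /andP[su tu].
have up_m : u < p.
  have u_le : u <= p by apply: maxp; rewrite su ltnW.
  rewrite ltn_neqAle u_le andbT; apply: contra tp => /eqP <- //.
have vm := ltn_ord v; have um := ltn_ord u.
(* A crossing of [p'] with the earlier chord [u] would place [s p.+1] between [s p] and [t u], hence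
   in [[a, b)], against the maximality of [p]. *)
have [vp|vp] := eqVneq v p'.
  rewrite vp /G' /chord_graph /= /crossing /right_neighbor /source /sink /= /s' in uv.
  have h : s u.+1 < s p.+1 by exact: (source_mono wf).
  have h2 : s u < s p by apply: (source_mono wf) => //; exact: ltnW.
  have h3 : s p < s p.+1 by exact: (source_mono wf).
  rewrite /inside in spp sp tu; case/andP: sp tu => ap _ /andP[_ ub].
  by case/orP: uv => /and3P[e1 e2 _]; [case/negP: spp|]; clear -ap ub e1 e2 h h3; lia.
move: vS; rewrite vp andbT negbK => /eqP svt; rewrite -svt andbb.
by have /= <- := chord_graph_inside (a := a) (b := b) _ svt (shift_edge uv); rewrite /= su ?tu.
Qed.

(** If [G] is complete, the loss of a vertex suffices. Otherwise take a separating interval: if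
    chord [m] crosses its boundary, deleting [m] shrinks the separator; if not, the interval can be
    chosen with [m] outside. *)
Lemma shift_connectivity_lt : vertex_connectivity G' < vertex_connectivity G.
Proof.
have [cpl|[S dS ->]] := min_separator G.
  have := vertex_connectivity_leq_card G'.
  have -> : vertex_connectivity G = m by rewrite /vertex_connectivity cpl card_ord.
  by rewrite card_ord; lia.
have [a [b [x [y [sx tx sy ty sub]]]]] := separator_interval wf dS.
apply: leq_trans (subset_leq_card sub).
have neq (z : 'I_m.+1) : z != ord_max -> z < m.
  by move=> zm; rewrite ltn_neqAle -ltnS ltn_ord andbT.
have [lastC|] := boolP (ord_max \in crosses_interval m.+1 s t a b).
  pose S' : {set 'I_m} := [set i | up i \in crosses_interval m.+1 s t a b].
  apply: (@leq_ltn_trans #|S'|); last first.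
    apply: (card_lt_up lastC) => i; rewrite inE; split=> //.
    by rewrite -val_eqE /=; have := ltn_ord i; lia.
  have xm : x < m by apply: neq; apply: contraL lastC => /eqP<-; rewrite inE sx tx.
  have ym : y < m.
    by apply: neq; apply: contraL lastC => /eqP<-; rewrite inE (negbTE sy) (negbTE ty).
  apply: vertex_connectivity_leq.
  apply: (@disconnects_pred _ _ _ (fun i : 'I_m => inside a b (s i))
            (Ordinal xm) (Ordinal ym)) => //.
  - by rewrite !inE /= sx tx.
  - by rewrite !inE /= (negbTE sy) (negbTE ty).
  move=> u v; rewrite !inE /= !negbK => /eqP su /eqP sv /shift_edge uv.
  by have /= <- := chord_graph_inside su sv uv.
rewrite inE negbK /= => /eqP lastE.
have [sm|sm] := boolP (inside a b (s m)); last first.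
  by apply: (shift_connectivity_lt_interval sx tx) => //; rewrite -lastE.
have tm : inside a b (t m) by rewrite -lastE.
have all_lt (z : 'I_m.+1) : s z < b /\ t z < b.
  have := source_lt_sink wf (ltn_ord z).
  have tz : t z <= t m.
    have := ltn_ord z; rewrite ltnS leq_eqVlt => /orP[/eqP->//|/last_sink/ltnW//].
  by move: tm; rewrite /inside; lia.
(* Chord [m] is inside and has the largest sink, so all endpoints lie below [b]; the complement
   [[0, a)] is crossed by the same chords and leaves [m] outside. *)
have -> : crosses_interval m.+1 s t a b = crosses_interval m.+1 s t 0 a.
  by apply/setP => z; rewrite !inE /inside; have [] := all_lt z; lia.
have [? ?] := all_lt y.
apply: (@shift_connectivity_lt_interval _ _ y); move: sy ty sm tm; rewrite /inside; lia.
Qed.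

(* psi deletes, at x, the edge to its last right neighbor g and the edges to the
   chords whose sink lies between the sources of x and x + 1; the latter are
   not adjacent to x + 1. *)
Lemma shift_degree (x : 'I_m) :
  2 * vertex_connectivity G <= #|[set y | G' x y]| + m.+1.
Proof.
have xm := ltn_ord x.
have x1m : x.+1 < m.+1 by [].
pose N : {set 'I_m.+1} := [set y | G (up x) y].
pose N1 : {set 'I_m.+1} := [set y | G (Ordinal x1m) y].
have degN : vertex_connectivity G <= #|N|.
  exact: vertex_connectivity_leq_degree (chord_graph_irrefl s t (up x)).
have degN1 : vertex_connectivity G <= #|N1|.
  exact: vertex_connectivity_leq_degree (chord_graph_irrefl s t (Ordinal x1m)).
have exg : exists i, (i <= m) && (s i < t x).
  by exists x; rewrite ltnW // (source_lt_sink wf (ltnW xm)).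
have bndg i : (i <= m) && (s i < t x) -> i <= m by case/andP.
case: (ex_maxnP exg bndg) => g /andP[gm sg] maxg.
pose Ch : {set 'I_m.+1} := [set j : 'I_m.+1 | [&& j < x, s x < t j & t j < s x.+1]].
pose N' : {set 'I_m} := [set y | G' x y].
have sx : s x < s x.+1 by exact: (source_mono wf).
have cardN : #|N| <= #|N'| + #|Ch| + 1.
  rewrite -(card_imset N' (f := up)); last by move=> i j [] /val_inj.
  rewrite -(cards1 (inord g : 'I_m.+1)).
  apply: leq_trans (leq_trans (leq_card_setU _ _) (leq_add (leq_card_setU _ _) (leqnn _))).
  apply/subset_leq_card/subsetP => y; rewrite !inE => xy.
  have [->|yg] := eqVneq y (inord g); first by rewrite orbT.
  have {}yg : nat_of_ord y != g by apply: contra yg => /eqP<-; rewrite inord_val.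
  rewrite orbF; have ym := ltn_ord y.
  rewrite /G /chord_graph /= /crossing /right_neighbor /source /sink /= in xy.
  have y_le : s y < t x -> y < g.
    by move=> h; rewrite ltn_neqAle yg maxg // -ltnS ltn_ord h.
  have [yx|yx] := leqP x y.
    have sxy : s x <= s y by exact: source_leq.
    have ygt : y < g by apply: y_le; lia.
    have {}ym : y < m by lia.
    have -> : y = up (Ordinal ym) by exact: val_inj.
    apply/orP; left; apply: imset_f; rewrite inE /G' /chord_graph /=.
    rewrite /crossing /right_neighbor /source /sink /= /s'.
    have := source_leq ygt gm.
    have : x <> y :> nat by move=> e; move: xy; rewrite -e; lia.
    move=> xneqy; have : s x.+1 < s y.+1 by apply: (source_mono wf) => //; lia.
    by lia.
  have syx : s y < s x by apply: (source_mono wf) => //; exact: ltnW.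
  have [tyx|tyx] := ltnP (t y) (s x.+1); first by have -> : s x < t y by [lia]; rewrite orbT.
  have {}ym : y < m by lia.
  have -> : y = up (Ordinal ym) by exact: val_inj.
  apply/orP; left; apply: imset_f; rewrite inE /G' /chord_graph /=.
  rewrite /crossing /right_neighbor /source /sink /= /s'.
  have : s y.+1 < s x.+1 by exact: (source_mono wf).
  have := source_neq_sink wf x1m (ltn_ord y).
  by lia.
(* [N1] misses [x.+1] and all of [Ch]. Adding this to the bound on [#|N|] cancels [#|Ch| + 1]. *)
have cardCh : #|Ch| + 1 + #|N1| <= m.+1.
  have nCh : Ordinal x1m \notin Ch by rewrite inE /=; lia.
  have dis : (Ordinal x1m |: Ch) \subset ~: N1.
    apply/subsetP => y; rewrite !inE => /orP[/eqP->|]; first exact: chord_graph_irrefl.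
    case/and3P=> yx sxt tys.
    rewrite /G /chord_graph /= /crossing /right_neighbor /source /sink /=.
    by have := source_lt_sink wf (ltn_ord y); lia.
  have := subset_leq_card dis; rewrite cardsU1 nCh.
  by have := cardsC N1; rewrite card_ord /reverse_coercion; lia.
rewrite -/N'; move: degN degN1 cardN cardCh; rewrite /reverse_coercion; lia.
Qed.

(** Take an interval separating [G']. If some chord of [G] lies inside it, the chords of [G]
    crossing its boundary separate [G], are at most two more than those of [G'], and miss at least
    two of the [m.+1] chords; these bounds add up. If none does, all neighbors of [x] in [G'] cross
    the boundary and [shift_degree] applies. *)
Lemma shift_separator (S : {set 'I_m}) :
  disconnects G' S -> 2 * vertex_connectivity G <= #|S| + m.+1.
Proof.
move=> /(separator_interval chord_model_shift).
case=> a [b0 [x [y [sx tx sy ty sub]]]].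
apply: leq_trans (leq_add (subset_leq_card sub) (leqnn _)).
(* All endpoints in [G'] are below [t m], so cutting the interval there changes nothing for [G'] and
   puts the sink of [m] outside. *)
pose b := minn b0 (t m).
have lt_last i : i < m -> s i.+1 < t m /\ t i < t m.
  by move=> im; have := next_source_lt im; have := last_sink im; lia.
have insE i : i < m -> (inside a b0 (s i.+1) = inside a b (s i.+1)) *
    (inside a b0 (t i) = inside a b (t i)).
  by move=> /lt_last; rewrite /inside /b; split; lia.
have tm : ~~ inside a b (t m) by rewrite /inside /b; lia.
have xm := ltn_ord x; have ym := ltn_ord y.
rewrite /s' !insE // in sx tx sy ty.
have -> : crosses_interval m s' t a b0 = crosses_interval m s' t a b.
  by apply/setP => i; rewrite !inE /s' !insE.
clear sub insE lt_last; clearbody b.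
pose CR := crosses_interval m.+1 s t a b; pose CR' := crosses_interval m s' t a b.
have [/existsP[z /andP[sz tz]]|none] :=
    boolP [exists z : 'I_m.+1, inside a b (s z) && inside a b (t z)].
  (* If [s y] is inside but [s y.+1] is not, all sources from [s y.+1] on are at or beyond [b], so
     [m] is an outside chord. *)
  have [w sw tw] : exists2 w : 'I_m.+1, ~~ inside a b (s w) & ~~ inside a b (t w).
    have [syI|syI] := boolP (inside a b (s y)); last by exists (up y).
    exists ord_max => //=; have := source_leq ym (leqnn m).
    have : s y < s y.+1 by exact: (source_mono wf).
    by move: sy syI; rewrite /inside; lia.
  have kCR : vertex_connectivity G <= #|CR|.
    by apply: vertex_connectivity_leq; exact: interval_disconnects sz tz sw tw.
  have CR2 : #|CR| + 2 <= m.+1.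
    have zw : z != w by apply: contraNneq sw => <-.
    have dis : CR \subset ~: [set z; w].
      apply/subsetP => u; rewrite !inE; apply: contra => /orP[/eqP->|/eqP->].
        by rewrite sz tz.
      by rewrite (negbTE sw) (negbTE tw).
    have := subset_leq_card dis; have := cardsC [set z; w].
    by rewrite cards2 zw card_ord /reverse_coercion; clear; lia.
  pose Q i := (i <= m) && inside a b (s i).
  have exQ : exists i, Q i by exists z; rewrite /Q -ltnS ltn_ord.
  have bndQ i : Q i -> i <= m by case/andP.
  case: (ex_minnP exQ) => lo /andP[lom slo] minlo.
  case: (ex_maxnP exQ bndQ) => hi /andP[him shi] maxhi.
  (* The sources inside are those with index from [lo] to [hi]; replacing [s u] by [s u.+1] changes
     membership only at [lo.-1], which enters, and at [hi], which leaves. *)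
  have CRsub : CR \subset up @: CR' :|: [set inord lo.-1; inord hi].
    apply/subsetP => u; rewrite !inE => su.
    have [//|ulo] := eqVneq u (inord lo.-1); first by rewrite orbT.
    have [//|uhi] := eqVneq u (inord hi); first by rewrite !orbT.
    have {}ulo : nat_of_ord u != lo.-1 by apply: contra ulo => /eqP<-; rewrite inord_val.
    have {}uhi : nat_of_ord u != hi by apply: contra uhi => /eqP<-; rewrite inord_val.
    have um := ltn_ord u; rewrite !orbF.
    have um' : u < m.
      rewrite ltn_neqAle -ltnS um andbT; apply/eqP => e.
      have := maxhi m; move: su; rewrite /Q e (negbTE tm) leqnn eqbF_neg negbK.
      by move=> -> /(_ isT); rewrite leqNgt ltn_neqAle him -e eq_sym uhi.
    have -> : u = up (Ordinal um') by exact: val_inj.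
    apply: imset_f; rewrite inE /= /s'; rewrite (_ : inside a b (s u.+1) = inside a b (s u)) //.
    apply/idP/idP => h.
      have lou : lo <= u.
        have : lo <= u.+1 by apply: minlo; rewrite /Q um' h.
        rewrite leq_eqVlt => /orP[/eqP e|//].
        by rewrite e eqxx in ulo.
      apply: inside_between slo h _ (ltnW _); first exact: source_leq lou um.
      exact: (source_mono wf).
    have uh : u < hi by rewrite ltn_neqAle uhi maxhi // /Q h -ltnS um.
    apply: inside_between h shi (ltnW _) _; first exact: (source_mono wf).
    exact: source_leq uh him.
  have CR_le : #|CR| <= #|CR'| + 2.
    apply: leq_trans (subset_leq_card CRsub) (leq_trans (leq_card_setU _ _) _).
    rewrite card_imset; last by move=> i j [] /val_inj.
    by rewrite leq_add2l cards2; case: (_ != _).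
  rewrite -/CR'; move: kCR CR2 CR_le; rewrite /reverse_coercion; clear.
  move: #|CR| => c; lia.
apply: leq_trans (shift_degree x) _; rewrite leq_add2r; apply/subset_leq_card/subsetP => z.
rewrite inE => xz; have zm := ltn_ord z.
have out u : u < m.+1 -> inside a b (s u) -> inside a b (t u) -> False.
  by move=> um su tu; move/negP: none; apply; apply/existsP; exists (Ordinal um); rewrite /= su.
(* Otherwise the chord of larger index among [x] and [z] has its old source between the two shifted
   ones, and so lies inside in [G] too. *)
have : ~ (inside a b (s z.+1) && inside a b (t z)).
  case/andP=> sz tz; have [lt|lt|e] := ltngtP x z.
  - apply: (out z (ltnW zm)) => //; apply: inside_between sx sz _ (ltnW _).
      by apply: source_leq => //; exact: ltnW.
    exact: (source_mono wf).
  - apply: (out x (ltnW xm)) => //; apply: inside_between sz sx _ (ltnW _).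
      by apply: source_leq => //; exact: ltnW.
    exact: (source_mono wf).
  - by move: xz; rewrite (val_inj e); apply/negP; exact: chord_graph_irrefl.
rewrite inE /s' => not_in; apply: contraT; rewrite negbK => /eqP sz.
have /= := chord_graph_inside (a := a) (b := b) _ sz xz.
rewrite sx tx => /(_ erefl) sz'; case: not_in.
by rewrite -sz -[inside a b _]sz'.
Qed.

(** For [n = m.+1] and connectivity [n - k] of [G], this is the lower bound [n - 2k]. *)
Lemma shift_connectivity_geq :
  2 * vertex_connectivity G <= vertex_connectivity G' + m.+1.
Proof.
rewrite addnC -leq_subLR; apply: leq_vertex_connectivity => [|S dS].
  by have := vertex_connectivity_leq_card G; rewrite !card_ord; lia.
by rewrite leq_subLR addnC; exact: shift_separator.
Qed.

End Shift.

(** * The intersection graph of psi T *)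

Definition nth_source (C : seq chord) (i : nat) : nat := source (nth_chord C i).
Definition nth_sink (C : seq chord) (i : nat) : nat := sink (nth_chord C i).

Lemma nth_sources C i : nth 0 (sources C) i = nth_source C i.
Proof.
have [iC|iC] := ltnP i (size C); first by rewrite (nth_map (0, 0)).
by rewrite /nth_source /nth_chord !nth_default ?size_map.
Qed.

Lemma nth_sinks C i : nth 0 (sinks C) i = nth_sink C i.
Proof.
have [iC|iC] := ltnP i (size C); first by rewrite (nth_map (0, 0)).
by rewrite /nth_sink /nth_chord !nth_default ?size_map.
Qed.

Lemma ltn_rank_in r x y :
  x \in r -> y \in r -> (rank_in r x < rank_in r y) = (x < y).
Proof.
move=> xr yr; have [xy|yx] := ltnP x y; first exact: rank_in_lt.
apply/negbTE; rewrite -leqNgt; move: yx; rewrite leq_eqVlt => /orP[/eqP->//|yx].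
exact: ltnW (rank_in_lt xr yx).
Qed.

Lemma chord_model_diagram n (T : diagram n) : chord_model n (nth_source T) (nth_sink T).
Proof.
have sT := size_diagram (chordsP T).
case/and3P: (chordsP T) => srt lt /perm_uniq; rewrite iota_uniq cat_uniq.
case/and3P=> _ /hasPn disj unT; split.
- by move=> i im; apply: (allP lt); rewrite mem_nth ?sT.
- move=> i j ij jm; rewrite -!nth_sources.
  apply: (sorted_ltn_nth ltn_trans 0 srt) => //; rewrite inE size_map sT //.
  exact: ltn_trans ij jm.
- move=> i j im jm; rewrite -!nth_sinks => /eqP.
  by rewrite nth_uniq ?size_map ?sT // => /eqP.
- move=> i j im jm e; have := disj (nth_sink T j).
  rewrite -nth_sinks mem_nth ?size_map ?sT // => /(_ isT) /negP; apply.
  by rewrite nth_sinks -e -nth_sources mem_nth ?size_map ?sT.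
Qed.

Lemma mem_endpoints_diagram n (T : diagram n) x :
  (x \in endpoints T) = (0 < x <= 2 * n).
Proof.
case/and3P: (chordsP T) => _ _ /perm_mem->; rewrite mem_iota; lia.
Qed.

Section OneTerminal.
Variables (m : nat) (T : diagram m.+1).
Hypothesis term : one_terminal T.
Let s := nth_source T.
Let t := nth_sink T.
Let wf : chord_model m.+1 s t := chord_model_diagram T.
Let sT : size T = m.+1 := size_diagram (chordsP T).

Lemma has_right_neighbor i : i < m ->
  exists2 j, j < m.+1 & [/\ i < j, s j < t i & t i < t j].
Proof.
move=> im; have := forallP term (Ordinal (ltnW im : i < m.+1)).
rewrite /= ltnS im /= negbK => /hasP[c /(nthP (0, 0))[j jm <-]].
rewrite sT in jm; case/and3P => sij stij tij; exists j => //; split=> //.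
rewrite ltnNge; apply/negP => ji; have : s j <= s i.
  exact: (source_leq wf ji (ltnW im)).
by rewrite leqNgt sij.
Qed.

Lemma next_source_lt_sink i : i < m -> s i.+1 < t i.
Proof.
move=> /has_right_neighbor[j jm [ij st _]]; apply: leq_ltn_trans st.
exact: (source_leq wf ij).
Qed.

Lemma sink_lt_last i : i < m -> t i < t m.
Proof.
move: {2}(m - i) (leqnn (m - i)) => d; elim: d i => [|d IH] i h im.
  by rewrite leqn0 subn_eq0 leqNgt im in h.
have [j jm [ij _ tij]] := has_right_neighbor im.
have [->//|jm'] := eqVneq m j; apply: ltn_trans tij _; apply: IH; clear -h ij jm jm'; lia.
Qed.

(** Between consecutive sources there are only sinks, and the sink of [i] comes after [s i.+1], so
    the run stops just before the next source. *)
Lemma source_group_end i : i < m -> s i + group_sinks T (nth_chord T i) = (s i.+1).-1.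
Proof.
move=> im; have sii : s i < s i.+1 by exact: (source_mono wf).
have sit := next_source_lt_sink im.
have ciT : nth_chord T i \in chords T by rewrite mem_nth // sT ltnW.
have src_sink j : j < m.+1 -> s j \notin sinks T.
  move=> jm; apply/negP => /(nthP 0)[l]; rewrite size_map sT => lm.
  by rewrite nth_sinks => e; have := source_neq_sink wf jm lm; rewrite -e.
have ub : ~~ (s i < s i.+1 <= s i + group_sinks T (nth_chord T i)).
  by apply/negP => /group_sinksP; rewrite (negbTE (src_sink _ _)).
have sm : s i.+1 <= 2 * m.+1.
  have : s i.+1 \in endpoints T.
    by rewrite mem_cat -[s i.+1]nth_sources mem_nth // size_map sT.
  by rewrite mem_endpoints_diagram => /andP[].
suff : s i.+1 <= (s i + group_sinks T (nth_chord T i)).+1 by clear -sii ub; lia.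
rewrite leqNgt; apply/negP; set x := (s i + _).+1 => xs.
have lt : group_sinks T (nth_chord T i) < 2 * size T by rewrite sT; clear -xs sm; lia.
have := @nth_find _ 0 (fun y => (y \notin sinks T) || (y == sink (nth_chord T i)))
   (iota (source (nth_chord T i)).+1 (2 * size T)).
rewrite has_find size_iota -/(group_sinks _ _) lt nth_iota // => /(_ isT).
rewrite (_ : _ + group_sinks _ _ = x) // => /orP[|/eqP e]; last first.
  by have := ltn_trans xs sit; rewrite e ltnn.
have : x \in endpoints T by rewrite mem_endpoints_diagram; clear -xs sm; lia.
rewrite mem_cat => /orP[|->//] /(nthP 0)[j]; rewrite size_map sT nth_sources => jm e _.
have [ji|ij] := leqP j i.
  have := source_leq wf ji (ltnW im); rewrite -[s j]/(nth_source T j) e /x.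
  by clear; lia.
have := source_leq wf ij jm; rewrite -[s j]/(nth_source T j) e.
by clear -xs; lia.
Qed.

(** [b] records whether the sink moves one place left. Membership among the endpoints lets ranks be
    compared as the points themselves. *)
Lemma psi_nth i : i < m -> exists2 b : bool,
  nth_chord (psi T) i =
  (rank_in (endpoints (delete_last (move_sources T))) (s i.+1).-1,
   rank_in (endpoints (delete_last (move_sources T))) (t i - b)) &
  ((s i.+1).-1 \in endpoints (delete_last (move_sources T))) &&
  (t i - b \in endpoints (delete_last (move_sources T))).
Proof.
move=> im; set D := delete_last _.
have sD : size D = m by rewrite size_takel // size_map sT.
have nD : nth_chord D i = moved_chord T (nth_chord T i).
  rewrite /nth_chord /D /delete_last nth_take ?size_map ?sT //.
  by rewrite (nth_map (0, 0)) // sT ltnW.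
exists (has (fun d => in_group T d (sink (nth_chord T i))) T).
  rewrite /nth_chord /= /psi_chords /relabel (nth_map (0, 0)) ?sD //.
  rewrite -/D -/(nth_chord D i) nD /moved_chord /source /sink /=.
  by rewrite -[fst _]/(s i) source_group_end.
apply/andP; split; rewrite mem_cat.
  rewrite -source_group_end // -[_ + _]/(source (moved_chord T (nth_chord T i))) -nD.
  by rewrite map_f // mem_nth // sD.
rewrite -[_ - _]/(sink (moved_chord T (nth_chord T i))) -nD.
by rewrite [X in _ || X]map_f ?orbT // mem_nth // sD.
Qed.

Lemma psi_right_neighbor i j : i < m -> j < m ->
  right_neighbor (nth_chord (psi T) i) (nth_chord (psi T) j) =
  right_neighbor (s i.+1, t i) (s j.+1, t j).
Proof.
move=> im jm; have [bi ei /andP[si ti]] := psi_nth im.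
have [bj ej /andP[sj tj]] := psi_nth jm.
(* The moved sinks are distinct because [psi T] is a diagram; lowering each by at most one then
   cannot exchange two of them. *)
have := sink_inj (chord_model_diagram (psi T)) im jm.
rewrite /nth_sink ei ej {ei ej}.
rewrite /right_neighbor /source /sink /= !ltn_rank_in //.
have := source_neq_sink wf (i := j.+1) (j := i) jm (ltnW im).
have : 0 < s i.+1 by apply: leq_ltn_trans (source_mono wf (ltnSn i) im).
have : 0 < s j.+1 by apply: leq_ltn_trans (source_mono wf (ltnSn j) jm).
have [->|ij] := eqVneq i j; first by rewrite !ltnn.
move=> hj hi hji neq.
have {}neq : t i - bi <> t j - bj by move=> e; case/eqP: ij; apply: neq; rewrite e.
have tij : t i <> t j by move/(sink_inj wf (ltnW im) (ltnW jm))/eqP; rewrite (negbTE ij).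
have := source_lt_sink wf (ltnW im); have := source_lt_sink wf (ltnW jm).
move: (s j) (s i) (s j.+1) (s i.+1) (t i) (t j) hj hi hji neq tij; clear.
move=> a a' sj si ti tj hj hi hji neq tij h1 h2.
have -> : (si.-1 < sj.-1) = (si < sj) by lia.
have -> : (sj.-1 < ti - bi) = (sj < ti) by case: bi neq; lia.
by congr [&& _, _ & _]; case: bi neq; case: bj => /=; lia.
Qed.

Lemma connectivity_psi :
  connectivity (psi T) = vertex_connectivity (chord_graph m (fun i => s i.+1) t).
Proof.
apply: eq_vertex_connectivity => i j.
by rewrite /intersection_graph /chord_graph /= /crossing !psi_right_neighbor.
Qed.

End OneTerminal.

(** * Extremal diagrams *)

Lemma card_ord_interval n a b : b <= n -> #|[set i : 'I_n | a <= i < b]| = b - a.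
Proof.
move=> bn; rewrite -sum1dep_card -(big_mkord (fun i => a <= i < b) (fun=> 1)).
rewrite -(big_nat_widen 0 b n (fun i => a <= i)) //.
by rewrite -(big_nat_widenl a 0 b predT) // sum_nat_const_nat muln1.
Qed.

(** Remove fewer than [c] vertices. A remaining vertex below [e] keeps a neighbor of larger index,
    so it climbs to [e] or above; two remaining vertices there are adjacent or keep a common
    neighbor. *)
Lemma vertex_connectivity_geq_ladder n (g : rel 'I_n) c e :
    symmetric g -> c < n ->
    (forall i : 'I_n, i < e -> c <= #|[set j : 'I_n | (i < j) && g i j]|) ->
    (forall x y : 'I_n, e <= x -> x < y -> ~~ g x y ->
       c <= #|[set z | g x z && g y z]|) ->
  c <= vertex_connectivity g.
Proof.
move=> sym cn right common; apply: leq_vertex_connectivity => [|S].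
  by rewrite card_ord; lia.
apply: contraLR; rewrite -ltnNge => Sc.
have pick (N : {set 'I_n}) : c <= #|N| -> exists2 z, z \in N & z \notin S.
  move=> cN; apply/subsetPn; apply: contraL (leq_trans Sc cN).
  by move/subset_leq_card; rewrite -leqNgt.
have csym : connect_sym (remove_vertices g S).
  apply: sym_connect_sym => x y /=.
  by rewrite /remove_vertices /= sym andbCA.
have climb d (x : 'I_n) : n - x <= d -> x \notin S -> exists x' : 'I_n,
    [/\ e <= x', x' \notin S & connect (remove_vertices g S) x x'].
  elim: d x => [|d IH] x dx xS; first by have := ltn_ord x; lia.
  have [ex|xe] := leqP e x; first by exists x; rewrite connect0.
  have [z] := pick _ (right x xe); rewrite inE => /andP[xz gxz] zS.
  have [|x' [ex' xS' zx']] := IH z _ zS; first by have := ltn_ord z; lia.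
  exists x'; split=> //; apply: connect_trans zx'; apply: connect1.
  exact/and3P.
have top (x y : 'I_n) : e <= x -> x < y -> x \notin S -> y \notin S ->
    connect (remove_vertices g S) x y.
  move=> ex xy xS yS; have [gxy|gxy] := boolP (g x y).
    by apply: connect1; exact/and3P.
  have [z] := pick _ (common x y ex xy gxy); rewrite inE => /andP[xz yz] zS.
  by apply: (@connect_trans _ _ z); apply: connect1; apply/and3P; rewrite // sym.
apply/negP => /existsP[x /existsP[y /and3P[xS yS /negP]]]; apply.
have [x' [ex' xS' xx']] := climb _ x (leqnn _) xS.
have [y' [ey' yS' yy']] := climb _ y (leqnn _) yS.
apply: connect_trans xx' _; rewrite csym; apply: connect_trans yy' _; rewrite csym.
have [xy|yx|/val_inj->] := ltngtP x' y'; last exact: connect0.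
  exact: top.
by rewrite csym; exact: top.
Qed.

Lemma model_is_diagram n s t :
    chord_model n s t -> (forall i, i < n -> 0 < s i) -> (forall i, i < n -> t i <= 2 * n) ->
  is_diagram n (mkseq (fun i => (s i, t i)) n).
Proof.
move=> wf s_gt0 t_le.
have srcE : sources (mkseq (fun i => (s i, t i)) n) = mkseq s n by rewrite /sources -map_comp.
have snkE : sinks (mkseq (fun i => (s i, t i)) n) = mkseq t n by rewrite /sinks -map_comp.
have srt : sorted ltn (mkseq s n).
  apply/(sortedP 0) => i; rewrite size_mkseq => im.
  by rewrite !nth_mkseq //; [exact: (source_mono wf) | exact: ltnW].
apply/and3P; split; first by rewrite srcE.
  apply/allP => x /mapP[i]; rewrite mem_iota => im ->.
  exact: (source_lt_sink wf).
have unE : uniq (endpoints (mkseq (fun i => (s i, t i)) n)).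
  rewrite cat_uniq srcE snkE (sorted_uniq ltn_trans ltnn srt) /=; apply/andP; split.
    apply/hasPn => x /mapP[j]; rewrite mem_iota => jm ->; apply/negP => /mapP[i].
    by rewrite mem_iota => im /esym; exact: (source_neq_sink wf im jm).
  rewrite map_inj_in_uniq ?iota_uniq // => i j; rewrite !mem_iota => im jm.
  exact: (sink_inj wf).
apply: uniq_perm => //; first exact: iota_uniq.
have [] // := uniq_min_size unE (s2 := iota 1 (2 * n)).
  move=> x; rewrite mem_cat srcE snkE mem_iota => /orP[] /mapP[i]; rewrite mem_iota => im ->.
    by have := s_gt0 i im; have := t_le i im; have := source_lt_sink wf im; lia.
  by have := s_gt0 i im; have := t_le i im; have := source_lt_sink wf im; lia.
by rewrite size_iota size_endpoints size_mkseq.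
Qed.

Section Extremal.
Variables (e c r : nat).
Hypothesis rc : r < c.
Let m := e + c + r.

(* Each of the first e chords has exactly the next c chords as right neighbors.
   Among the last c + r + 1 chords e, ..., m, the non-crossing pairs form two
   stars with r edges each: m with e, ..., e + r - 1, and m - 1 with
   e + c - 1, ..., m - 2.  Thus m has degree c, and the r chords e, ...,
   e + r - 1 have their last crossing with m - 1, which psi removes. *)
Definition extremal_source i :=
  if i < m then i.+1 + minn (i - c) e else m.+1 + e + r.

(** For [i < e] the sink directly follows the source of [i + c]. The next [r] sinks directly precede
    the source of [m], and [m - 1] ends before [e + c - 1, ..., m - 2]. *)
Definition extremal_sink i :=
  if i < e then i.*2 + c + 2
  else if i < e + r then m.+1 + i
  else if i.+1 < e + c then m.+1 + i.+1
  else if i.+1 < m then m.+1 + i.+2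
  else if i < m then m.+1 + e + c
  else 2 * m.+1.

Lemma extremal_model : chord_model m.+1 extremal_source extremal_sink.
Proof.
rewrite /extremal_source /extremal_sink /m; split.
- by move=> i; do !case: ifP => ?; lia.
- by move=> i j; do !case: ifP => ?; lia.
- by move=> i j im jm; do !case: ifP => ?; lia.
- by move=> i j im jm; do !case: ifP => ?; lia.
Qed.

Lemma extremal_is_diagram :
  is_diagram m.+1 (mkseq (fun i => (extremal_source i, extremal_sink i)) m.+1).
Proof.
apply: (model_is_diagram extremal_model) => i; rewrite /extremal_source /extremal_sink /m.
  by do !case: ifP => ?; lia.
by do !case: ifP => ?; lia.
Qed.

Definition extremal_diagram : diagram m.+1 := Diagram extremal_is_diagram.

Lemma extremal_crossing_last i : i < m ->
  crossing (extremal_source i, extremal_sink i) (extremal_source m, extremal_sink m) = (e + r <= i).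
Proof.
rewrite /crossing /right_neighbor /source /sink /= /extremal_source /extremal_sink /m => im.
by do !case: ifP => ?; lia.
Qed.

Lemma extremal_crossing i j : i < j -> j < m -> (e <= i) || (j <= i + c) ->
  crossing (extremal_source i, extremal_sink i) (extremal_source j, extremal_sink j) =
  ((j.+1 < m) || (i.+1 < e + c)).
Proof.
rewrite /crossing /right_neighbor /source /sink /= /extremal_source /extremal_sink /m => ij jm h.
by do !case: ifP => ?; lia.
Qed.

Lemma extremal_crossing_shift i j : i < j -> j < m -> (e <= i) || (j < i + c) ->
  crossing (extremal_source i.+1, extremal_sink i) (extremal_source j.+1, extremal_sink j) =
  ((j.+1 < m) || (e + r <= i) && (i.+1 < e + c)).
Proof.
rewrite /crossing /right_neighbor /source /sink /= /extremal_source /extremal_sink /m => ij jm h.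
by do !case: ifP => ?; lia.
Qed.

Lemma extremal_crossing_shift_last i j : i < j -> j.+1 = m ->
  crossing (extremal_source i.+1, extremal_sink i) (extremal_source j.+1, extremal_sink j) =
  (e + r <= i) && (i.+1 < e + c).
Proof.
rewrite /crossing /right_neighbor /source /sink /= /extremal_source /extremal_sink /m => im.
by do !case: ifP => ?; lia.
Qed.

Lemma extremal_one_terminal : one_terminal extremal_diagram.
Proof.
apply/forallP => -[i /= _]; apply/implyP; rewrite ltnS => im; rewrite negbK.
(* The middle case is that of the [r] chords ending before the source of [m]. *)
pose j := if i < e then i + c else if i < e + r then m.-1 else m.
have jm : j <= m by rewrite /j /m; do !case: ifP => ?; lia.
apply/hasP; exists (extremal_source j, extremal_sink j).
  by apply/mapP; exists j; rewrite // mem_iota ltnS.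
rewrite /nth_chord nth_mkseq ?leqW // /right_neighbor /source /sink /=.
move: im; rewrite /j /extremal_source /extremal_sink /m; clear jm j.
by case: (ltnP i e) => ?; [|case: (ltnP i (e + r)) => ?]; (do !case: ifP => ?); lia.
Qed.

Lemma extremal_connectivity :
  vertex_connectivity (chord_graph m.+1 extremal_source extremal_sink) = c.
Proof.
have mE : m = e + c + r by [].
set g := chord_graph _ _ _; have sym : symmetric g by exact: chord_graph_sym.
have irr x : g x x = false by apply/negbTE; exact: chord_graph_irrefl.
have gE (x y : 'I_m.+1) :
    g x y = crossing (extremal_source x, extremal_sink x)
                     (extremal_source y, extremal_sink y).
  by [].
have last (x y : 'I_m.+1) : x < m -> y = m :> nat -> g x y = (e + r <= x).
  by move=> xm ym; rewrite gE ym; exact: extremal_crossing_last.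
have low (x z : 'I_m.+1) : x != z :> nat -> e <= x < m -> e <= z < m ->
    (x.+1 < m) && (z.+1 < m) || ((minn x z).+1 < e + c) -> g x z.
  wlog xz : x z / x < z => [hwlog|] xneqz ex ez h.
    have [xz|zx|eq] := ltngtP x z; first exact: hwlog.
      by rewrite sym; apply: hwlog; rewrite // 1?eq_sym // minnC 1?[X in X || _]andbC.
    by rewrite eq eqxx in xneqz.
  by rewrite gE extremal_crossing //; lia.
apply/eqP; rewrite eqn_leq; apply/andP; split.
  apply: leq_trans (vertex_connectivity_leq_degree (chord_graph_irrefl _ _ ord_max)) _.
  have cE : c = m - (e + r) by lia.
  rewrite [leqRHS]cE -(@card_ord_interval m.+1 (e + r) m) //.
  apply/subset_leq_card/subsetP => y; rewrite !inE -/g => my.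
  have [yE|ym] := eqVneq y ord_max.
    by rewrite yE irr in my.
  have {}ym : y < m by rewrite ltn_neqAle ym -ltnS ltn_ord.
  by rewrite -(last y ord_max) // sym my.
apply: (@vertex_connectivity_geq_ladder _ _ c e) => // [|i ie|x y ex xy].
- by lia.
- have cE : c = (i + c).+1 - i.+1 by lia.
  rewrite [leqLHS]cE -(@card_ord_interval m.+1) ?ltnS; last by lia.
  apply/subset_leq_card/subsetP => j; rewrite !inE ltnS => /andP[ij jic].
  have jm : j < m by lia.
  by rewrite ij gE extremal_crossing ?jic ?orbT //; lia.
have xm : x < m by rewrite -ltnS (leq_trans _ (ltn_ord y)).
have [ym|ym] := eqVneq (y : nat) m.
  (* Here [x] is one of [e, ..., e + r - 1], and it crosses all [c] neighbors of [m]. *)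
  rewrite last // -ltnNge => xer.
  have cE : c = m - (e + r) by lia.
  rewrite [leqLHS]cE -(@card_ord_interval m.+1 (e + r) m) //.
  apply/subset_leq_card/subsetP => z; rewrite !inE => /andP[erz zm].
  rewrite [g y z]sym (last z y) // erz andbT.
  by apply: low; lia.
have {}ym : y < m by rewrite ltn_neqAle ym -ltnS ltn_ord.
rewrite gE extremal_crossing ?ex //.
rewrite negb_or -!leqNgt => /andP[my ecx].
(* Here [y] is [m - 1] and [x] is at least [e + c - 1]; both cross [m] and the [c - 1] chords
   [e, ..., e + c - 2]. *)
have nI : ord_max \notin [set z : 'I_m.+1 | e <= z < (e + c).-1].
  by rewrite inE /=; lia.
have cE : c = #|ord_max |: [set z : 'I_m.+1 | e <= z < (e + c).-1]|.
  rewrite cardsU1 nI card_ord_interval; last by lia.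
  by move: rc; clear; lia.
rewrite [leqLHS]cE; apply/subset_leq_card/subsetP => z; rewrite !inE => /orP[/eqP->|ez].
  by rewrite !last //=; lia.
by apply/andP; split; apply: low; lia.
Qed.

(** The neighbors of [m - 1] are now among [e + r, ..., e + c - 2]. Every non-crossing pair at or
    above [e] contains [m - 1], and its other chord crosses all of these. *)
Lemma extremal_connectivity_shift :
  vertex_connectivity (chord_graph m (fun i => extremal_source i.+1) extremal_sink) = c.-1 - r.
Proof.
have mE : m = e + c + r by [].
set g := chord_graph _ _ _; have sym : symmetric g by exact: chord_graph_sym.
have irr x : g x x = false by apply/negbTE; exact: chord_graph_irrefl.
have gE (x y : 'I_m) :
    g x y = crossing (extremal_source x.+1, extremal_sink x)
                     (extremal_source y.+1, extremal_sink y) by [].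
have last (x y : 'I_m) : x < y -> y.+1 = m :> nat -> g x y = (e + r <= x) && (x.+1 < e + c).
  exact: extremal_crossing_shift_last.
have m_gt0 : 0 < m by lia.
have lm : m.-1 < m by lia.
pose l := Ordinal lm.
apply/eqP; rewrite eqn_leq; apply/andP; split.
  apply: leq_trans (vertex_connectivity_leq_degree (chord_graph_irrefl _ _ l)) _.
  have cE : c.-1 - r = (e + c).-1 - (e + r) by lia.
  rewrite [leqRHS]cE -(@card_ord_interval m (e + r) (e + c).-1); last by lia.
  apply/subset_leq_card/subsetP => y; rewrite !inE -/g => ly.
  have [yE|yl] := eqVneq y l.
    by rewrite yE irr in ly.
  have {}yl : y < l.
    by rewrite ltn_neqAle yl /= -ltnS prednK.
  by move: ly; rewrite sym last //= ?prednK //; lia.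
apply: (@vertex_connectivity_geq_ladder _ _ _ e) => // [|i ie|x y ex xy].
- by lia.
- apply: (@leq_trans c.-1); first exact: leq_subr.
  have cE : c.-1 = i + c - i.+1 by lia.
  rewrite [leqLHS]cE -(@card_ord_interval m); last by lia.
  apply/subset_leq_card/subsetP => j; rewrite !inE => /andP[ij jic].
  by rewrite ij gE extremal_crossing_shift ?jic ?orbT //; lia.
have ym := ltn_ord y.
rewrite gE extremal_crossing_shift ?ex //.
rewrite negb_or -leqNgt => /andP[my last_y].
have {}my : y.+1 = m by apply/eqP; rewrite eqn_leq my ym.
have cE : c.-1 - r = (e + c).-1 - (e + r) by lia.
rewrite [leqLHS]cE -(@card_ord_interval m (e + r) (e + c).-1); last by lia.
apply/subset_leq_card/subsetP => z; rewrite !inE => /andP[erz zec].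
rewrite [g y z]sym (last z y) //; last by lia.
have -> : (e + r <= z) && (z.+1 < e + c) by lia.
have [xz|zx|xz] := ltngtP x z; last by move: last_y; lia.
  by rewrite gE extremal_crossing_shift ?ex //; lia.
by rewrite sym gE extremal_crossing_shift //; lia.
Qed.

Lemma nth_chord_extremal_diagram i :
  i <= m -> nth_chord extremal_diagram i = (extremal_source i, extremal_sink i).
Proof. by move=> im; rewrite /nth_chord nth_mkseq. Qed.

Lemma connectivity_extremal_diagram : connectivity extremal_diagram = c.
Proof.
rewrite -[RHS]extremal_connectivity; apply: eq_vertex_connectivity => i j.
rewrite /intersection_graph /chord_graph [LHS]/=.
by rewrite !nth_chord_extremal_diagram // -ltnS ltn_ord.
Qed.

Lemma connectivity_psi_extremal_diagram : connectivity (psi extremal_diagram) = c.-1 - r.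
Proof.
rewrite (connectivity_psi extremal_one_terminal) -[RHS]extremal_connectivity_shift.
apply: eq_vertex_connectivity => i j.
pose C := nth_chord extremal_diagram.
rewrite -[LHS]/(crossing (source (C i.+1), sink (C i)) (source (C j.+1), sink (C j))).
by rewrite /C !nth_chord_extremal_diagram // ltnW.
Qed.

End Extremal.

(** * The bounds, and diagrams for every value between them *)

Theorem theorem8p19 (n k : nat) (hk : 1 <= k < n) :
  (forall T : diagram n,
     one_terminal T -> connectivity T = n - k ->
     n - 2 * k <= connectivity (psi T) < n - k)
  /\
  (forall j : nat, n - 2 * k <= j < n - k ->
     exists T : diagram n,
       [/\ one_terminal T, connectivity T = n - k & connectivity (psi T) = j]).
Proof.
split=> [T|j hj].
  case: n T hk => [|m] T; first by rewrite ltn0 andbF.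
  case/andP=> k_gt0 kn term cT.
  have m_gt0 : 0 < m by lia.
  have wf := chord_model_diagram T.
  have nxt := next_source_lt_sink term; have lst := sink_lt_last term.
  have lt := shift_connectivity_lt wf m_gt0 nxt lst.
  have ge := shift_connectivity_geq wf m_gt0 nxt lst.
  have kT : vertex_connectivity (chord_graph m.+1 (nth_source T) (nth_sink T)) = m.+1 - k by [].
  by rewrite -(connectivity_psi term) kT in lt ge; clear -lt ge k_gt0 kn; lia.
(* [r] is chosen so that [c.-1 - r] is [j], and [e] pads the size to [n]; [n - 2 * k <= j] gives
   [r < k], so the subtraction in [e] is not truncated. *)
pose c := n - k; pose r := c.-1 - j; pose e := k - r.+1.
have rc : r < c by lia.
have nE : n = (e + c + r).+1 by lia.
have kE : n - k = c by [].
have jE : j = c.-1 - r by lia.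
rewrite kE jE; clearbody e r c; subst n.
exists (extremal_diagram e rc); split.
- exact: extremal_one_terminal.
- exact: connectivity_extremal_diagram.
- exact: connectivity_psi_extremal_diagram.
Qed.
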